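(* Let $n,r\ge1$ be integers. There is an isomorphism of $\mathbb{Z}$-algebras $G(n,r)\to M(n,r)\times\bigl(G(n,r)/M(n,r)\bigr)$ given by $e_A\mapsto(\omega(e_A),\overline{e_A})$, where $\overline{e_A}$ is the class of $e_A$ in the quotient.
   Context: Generic algebra $G(n,r)$. Let $k$ be an algebraically closed field, $V$ an $r$-dimensional $k$-space, $\mathcal{F}$ the variety of $n$-step flags $f:\{0\}=V_0\subseteq\cdots\subseteq V_n=V$. $\mathrm{GL}(V)$-orbits in $\mathcal{F}\times\mathcal{F}$ (diagonal action) are in bijection with $n\times n$ matrices of non-negative integers with entries summing to $r$ via $A(f,f')_{ij}=\dim(V_{i-1}+V_i\cap V'_j)-\dim(V_{i-1}+V_i\cap V'_{j-1})$; $e_A$ is the orbit with matrix $A$. Let $S(A,A')=\{(f_1,f_2): \exists f\in\mathcal{F},\ (f_1,f)\in e_A,\ (f,f_2)\in e_{A'}\}$; if non-empty it contains a unique $\mathrm{GL}(V)$-orbit open in it (Zariski topology). $G(n,r)$ is the free $\mathbb{Z}$-module with basis the orbits $e_A$ and bilinear associative product $e_A\star e_{A'}$ equal to the open orbit in $S(A,A')$ if $S(A,A')\ne\emptyset$, and $0$ otherwise. $D(n,r)$ is the set of $n$-tuples $\underline d$ of non-negative integers with sum $r$, and $\mathcal{F}_{\underline d}$ is the set of flags with $\dim V_i-\dim V_{i-1}=d_i$ for all $i$. For $\underline d,\underline e\in D(n,r)$, $o_{\underline d,\underline e}$ is the unique open $\mathrm{GL}(V)$-orbit in $\mathcal{F}_{\underline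 d}\times\mathcal{F}_{\underline e}$, and $o_{\underline d}=o_{\underline d,\underline d}$. $M(n,r)\subseteq G(n,r)$ is the $\mathbb{Z}$-submodule with basis all $o_{\underline d,\underline e}$; it is a two-sided ideal of $G(n,r)$, and is itself a $\mathbb{Z}$-algebra under $\star$ with identity $\sum_{\underline d}o_{\underline d}$. The $\mathbb{Z}$-linear map $\omega:G(n,r)\to M(n,r)$ is defined by $\omega(e_A)=o_{\underline d,\underline e}$ for $e_A\subseteq\mathcal{F}_{\underline d}\times\mathcal{F}_{\underline e}$. *)

(* Defs.v *)
From HB Require Import structures.
From mathcomp Require Import mpoly freeg.
From mathcomp Require Import all_boot all_order all_algebra.
From mathcomp Require Import boolp classical_sets.

Set Implicit Arguments.
Unset Strict Implicit.
Unset Printing Implicit Defensive.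

Import GRing.Theory.

Local Open Scope ring_scope.
Local Open Scope classical_set_scope.

Section Flags.
Variables (k : fieldType) (V : vectType k) (n : nat).

Definition is_flag (f : {ffun 'I_n.+1 -> {vspace V}}) : bool :=
  [&& f ord0 == 0%VS, f ord_max == fullv &
      [forall i : 'I_n, (f (widen_ord (leqnSn n) i) <= f (lift ord0 i))%VS]].

Definition flag := {f : {ffun 'I_n.+1 -> {vspace V}} | is_flag f}.

Definition jump (f : flag) (i : 'I_n) : nat :=
  (\dim (val f (lift ord0 i)) - \dim (val f (widen_ord (leqnSn n) i)))%N.

Definition GL := {g : 'End(V) | lker g == 0%VS}.

Lemma act_subproof (g : GL) (f : flag) :
  is_flag [ffun i => (val g @: val f i)%VS].
Proof.
case: f => f /= /and3P[/eqP f0 /eqP fn /forallP fi].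
apply/and3P; split; rewrite ?ffunE ?f0 ?fn ?limg0 //.
  by rewrite eqEdim subvf limg_dim_eq ?leqnn // (eqP (valP g)) capv0.
by apply/forallP => i; rewrite !ffunE limgS.
Qed.

Definition act (g : GL) (f : flag) : flag := Sub _ (act_subproof g f).

Definition GLorbit (p : flag * flag) : set (flag * flag) :=
  [set q | exists g : GL, q = (act g p.1, act g p.2)].

(* The basis elements e_A are the orbits themselves; the matrix A only labels
   the orbit. *)
Definition orbit_type :=
  {X : set (flag * flag) | `[< exists p, X = GLorbit p >]}.

(* Zariski topology on GL(V) x GL(V), as an open subset of the affine space
   End(V) x End(V): complements of zero loci of families of polynomials. *)
Definition End2 : vectType k := ('End(V) * 'End(V))%type.

Definition coords (gh : GL * GL) : 'I_(\dim {:End2}) -> k :=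
  fun i => coord (vbasis {:End2}) i (val gh.1, val gh.2).

Definition GL2_open (Y : set (GL * GL)) : Prop :=
  exists I : set {mpoly k[\dim {:End2}]},
    Y = ~` [set gh | forall q, I q -> q.@[coords gh] = 0].

(* Zariski topology on the variety of pairs of flags.  This variety is the
   disjoint union of the homogeneous spaces (GL(V) x GL(V)) / (P x Q), with P, Q
   parabolic subgroups, each of which is open and closed and carries the
   quotient topology along the orbit map (g, h) |-> (g f, h f') of any of its
   points (f, f'). *)
Definition zariski_open (U : set (flag * flag)) : Prop :=
  forall p, GL2_open [set gh | U (act gh.1 p.1, act gh.2 p.2)].

Definition open_in (S X : set (flag * flag)) : Prop :=
  exists2 U, zariski_open U & X = U `&` S.

(* The open orbit contained in S; None if there is none. *)
Definition open_orbit (S : set (flag * flag)) : option orbit_type :=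
  xget None [set oX | exists2 X : orbit_type,
                        oX = Some X & val X `<=` S /\ open_in S (val X)].

Definition comp_set (X Y : orbit_type) : set (flag * flag) :=
  [set p | exists f : flag, val X (p.1, f) /\ val Y (f, p.2)].

Definition Gnr := {freeg orbit_type / int}.
HB.instance Definition _ := GRing.Lmodule.on Gnr.

Definition e_orb (X : orbit_type) : Gnr := << X >>.

Definition e_opt (oX : option orbit_type) : Gnr := if oX is Some X then e_orb X else 0.

(* comp_set X Y contains an open orbit as soon as it is nonempty; if it is empty,
   it contains no orbit and the product is 0. *)
Definition star_orbit (X Y : orbit_type) : Gnr := e_opt (open_orbit (comp_set X Y)).

Definition star (x y : Gnr) : Gnr :=
  fglift (fun X => fglift (fun Y => star_orbit X Y) y) x.

End Flags.

Section Generic.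
Variables (k : fieldType) (V : vectType k) (n r : nat).

(* Entries of a tuple of naturals of sum r are at most r. *)
Definition Dnr := {d : n.-tuple 'I_r.+1 | (\sum_(i < n) tnth d i)%N == r}.

Definition Fl (d : Dnr) : set (flag V n) :=
  [set f | forall i, jump f i = tnth (val d) i].

(* The unit of G(n,r) is the sum of the diagonal orbits {(f, f) | f in Fl d};
   insub yields None on a set which is not an orbit. *)
Definition G_one : Gnr V n :=
  \sum_(d : Dnr) e_opt (insub [set p | Fl d p.1 /\ p.2 = p.1]).

Definition o_orb (d d' : Dnr) : Gnr V n := e_opt (open_orbit (Fl d `*` Fl d')).

Definition in_M : {pred Gnr V n} := fun x =>
  `[< exists c : Dnr -> Dnr -> int,
        x = \sum_(d : Dnr) \sum_(d' : Dnr) c d d' *: o_orb d d' >].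

Lemma in_M_submod : submod_closed in_M.
Proof.
split=> [|a x y /asboolP[c ->] /asboolP[c' ->]]; apply/asboolP.
  exists (fun _ _ => 0); rewrite big1 // => d _.
  by rewrite big1 // => d' _; rewrite scale0r.
exists (fun d d' => a * c d d' + c' d d').
rewrite scaler_sumr -big_split /=; apply: eq_bigr => d _.
rewrite scaler_sumr -big_split /=; apply: eq_bigr => d' _.
by rewrite scalerDl scalerA.
Qed.

HB.instance Definition _ :=
  GRing.isSubmodClosed.Build int (Gnr V n) in_M in_M_submod.

Definition Mnr := {x : Gnr V n | in_M x}.
HB.instance Definition _ := Choice.on Mnr.
HB.instance Definition _ := SubType.on Mnr.
HB.instance Definition _ := [SubChoice_isSubLmodule of Mnr by <:].

Lemma o_in_M (d d' : Dnr) : in_M (o_orb d d').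
Proof.
apply/asboolP; exists (fun x y => ((x == d) && (y == d'))%:R).
rewrite (bigD1 d) //= (bigD1 d') //= !eqxx scale1r !big1 ?addr0 //.
  by move=> x /negPf xd; rewrite big1 // => y _; rewrite xd scale0r.
by move=> y /negPf yd'; rewrite yd' andbF scale0r.
Qed.

Definition oM (d d' : Dnr) : Mnr := Sub (o_orb d d') (o_in_M d d').

Definition two_sided_ideal : Prop :=
  forall x y : Gnr V n, x \in in_M -> (star x y \in in_M) /\ (star y x \in in_M).

(* The restriction of star; insubd 0 is the identity on elements of M, hence on
   all products of elements of M as M is a two-sided ideal. *)
Definition M_mul (x y : Mnr) : Mnr := insubd (0 : Mnr) (star (val x) (val y)).

Definition M_one : Mnr := \sum_(d : Dnr) oM d d.

Definition omega_orbit (X : orbit_type V n) : Mnr :=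
  if [pick dd : Dnr * Dnr | `[< val X `<=` Fl dd.1 `*` Fl dd.2 >]] is Some dd
  then oM dd.1 dd.2 else 0.

Definition omega : Gnr V n -> Mnr := fglift omega_orbit.

Definition GmodM := Quotient.quot in_M.
HB.instance Definition _ := GRing.Zmodule.on GmodM.

Definition cls (x : Gnr V n) : GmodM := (\pi_GmodM x)%qT.

(* Independent of the representatives, M being a two-sided ideal. *)
Definition GmodM_mul (x y : GmodM) : GmodM := cls (star (repr x) (repr y)).

Definition GmodM_one : GmodM := cls G_one.

Definition prod_mul (x y : (Mnr * GmodM)%type) : (Mnr * GmodM)%type :=
  (M_mul x.1 y.1, GmodM_mul x.2 y.2).

Definition prod_one : (Mnr * GmodM)%type := (M_one, GmodM_one).

End Generic.

Record Zalgebra (A : zmodType) (mul : A -> A -> A) (one : A) : Prop := {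
  Zalg_mulA : associative mul;
  Zalg_mul1 : left_id one mul;
  Zalg_mulr1 : right_id one mul;
  Zalg_mulDl : left_distributive mul +%R;
  Zalg_mulDr : right_distributive mul +%R }.

Record Zalgebra_iso (A B : zmodType) (mulA : A -> A -> A) (oneA : A)
    (mulB : B -> B -> B) (oneB : B) (phi : A -> B) : Prop := {
  Zalg_isoD : {morph phi : x y / x + y};
  Zalg_isoM : {morph phi : x y / mulA x y >-> mulB x y};
  Zalg_iso1 : phi oneA = oneB;
  Zalg_iso_bij : bijective phi }.

(* Main.v *)
From HB Require Import structures.
Require Import Defs.
From mathcomp Require Import mpoly freeg.
From mathcomp Require Import all_boot all_order all_algebra.
From mathcomp Require Import ring.
From mathcomp Require Import boolp classical_sets.
Set Implicit Arguments.
Unset Strict Implicit.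
Unset Printing Implicit Defensive.

Import GRing.Theory.

Local Open Scope ring_scope.

(** Write rho(f, f')_ij for dim (V_i + V'_j).  Two facts about these numbers
    carry the proof.

    They classify orbits: if two pairs of flags have the same rho, then all the
    intersections V_i :&: V'_j have the same dimensions in both pairs, and a
    decomposition of V adapted to both flags of a pair produces an element of
    GL(V) conjugating the two pairs (adapted_iso, rho_orbit).

    They are lower semicontinuous: each condition rho_ij >= m is Zariski open
    (rho_open), since it is the nonvanishing of some determinant.

    Let X and Y be orbits such that S(X, Y) is nonempty, and fix (f1, b) in X
    and (b, f2) in Y.  Up to GL(V), the elements of S(X, Y) are the pairs
    (f1, h f2), with h in the stabiliser of b (comp_set_pair).  This stabiliser
    is irreducible, being open in a vector space; concretely, the line joining
    1 to h stays in that vector space, and a polynomial which does not vanish at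
    one point of a line vanishes at finitely many of its points only
    (stab_generic).
    Hence some pair in S(X, Y) maximises all the rho_ij simultaneously
    (generic_exists), and its orbit is the only open one (open_orbit_generic).
    The product of orbits is thus characterised by maximality of rho.  For
    associativity, both (X * Y) * Z and X * (Y * Z) maximise rho on the set of
    pairs (f1, f2) linked by two intermediate flags (orbit_mul3l, orbit_mul3r,
    orbit_mulA).

    The rest is formal.  As n >= 1, there is a flag b = (0, V, ..., V), and it is
    fixed by GL(V).  Then F_d x F_e = S(X, Y), where X is the single orbit
    F_d x {b} and Y is {b} x F_e; so o_{d,e} is the product of these two orbits, and
    associativity gives e_A * o_{d',e} = o_{d,e} for e_A in F_d x F_{d'}
    (star_e_o), together with its mirror image.  This makes M a two-sided ideal
    with unit the sum of the o_{d,d}, and omega a multiplicative retraction of G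
    onto M (omega_M, omega_mul).  A ring with an ideal I and a retraction
    onto I that respects sums and products is the product of I and the quotient
    by I. *)

(** * Subspaces adapted to two flags *)

Section AdaptedIso.
Variables (k : fieldType) (V : vectType k).
Implicit Types (U W : {vspace V}) (A B : nat -> {vspace V}).

Lemma lfun_img_eqdim U W : \dim U = \dim W -> exists phi : 'End(V), (phi @: U)%VS = W.
Proof.
move=> dUW.
pose F (v : V) := \sum_(i < \dim U) coord (vbasis U) i v *: (vbasis W)`_i.
have linF : linear F.
  move=> a u v; rewrite /F scaler_sumr -big_split; apply: eq_bigr => i _.
  by rewrite linearP scalerDl scalerA.
pose FL : {linear V -> V} := HB.pack F (GRing.isLinear.Build _ _ _ _ F linF).
exists (linfun FL).
rewrite -{1}(span_basis (vbasisP U)) -[RHS](span_basis (vbasisP W)) limg_span.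
congr (span _); apply: (@eq_from_nth _ 0) => [|i].
  by rewrite size_map !size_tuple.
rewrite size_map size_tuple => ltiU.
pose i0 := Ordinal ltiU.
have coordE j : coord (vbasis U) j (vbasis U)`_i = (i0 == j)%:R.
  exact: (coord_free i0 j (basis_free (vbasisP U))).
rewrite (nth_map 0) ?size_tuple // lfunE /= /F (bigD1 i0) //=.
rewrite coordE eqxx scale1r big1 ?addr0 // => j ji.
by rewrite coordE eq_sym (negPf ji) scale0r.
Qed.

(** A complement, in the (i+1, j+1) intersection of the two chains, of the part
    that comes from smaller indices.  These pieces split V compatibly with both
    chains. *)
Definition piece A B i j : {vspace V} :=
  ((A i.+1 :&: B j.+1) :\: (A i :&: B j.+1 + A i.+1 :&: B j))%VS.

Section OnePair.
Variables A B : nat -> {vspace V}.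
Hypotheses (A0 : A 0 = 0%VS) (B0 : B 0 = 0%VS).
Hypotheses (Amono : forall i, (A i <= A i.+1)%VS)
           (Bmono : forall i, (B i <= B i.+1)%VS).

Let smaller_sub i j : (A i :&: B j.+1 + A i.+1 :&: B j <= A i.+1 :&: B j.+1)%VS.
Proof. by rewrite subv_add !capvS. Qed.

Lemma piece_sub i j a b : (a < i)%N -> (b < j)%N -> (piece A B a b <= A i :&: B j)%VS.
Proof.
have mono (C : nat -> {vspace V}) : (forall m, (C m <= C m.+1)%VS) ->
    forall m p, (m <= p)%N -> (C m <= C p)%VS.
  move=> Cmono m p; elim: p => [|p IHp]; first by rewrite leqn0 => /eqP->.
  rewrite leq_eqVlt => /predU1P[-> //|mp]; exact: subv_trans (IHp mp) (Cmono p).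
by move=> ai bj; apply: subv_trans (diffvSl _ _) (capvS _ _); apply: mono.
Qed.

(** The pieces with indices below (i, j) span A i :&: B j: by induction, since
    each intersection is its own piece plus the two preceding intersections. *)
Lemma cap_le_pieces i j U :
    (forall a b, (a < i)%N -> (b < j)%N -> (piece A B a b <= U)%VS) ->
  (A i :&: B j <= U)%VS.
Proof.
elim: i j => [|i IHi] j; first by rewrite A0 cap0v sub0v.
elim: j => [|j IHj] sU; first by rewrite B0 capv0 sub0v.
have <- : (piece A B i j + (A i :&: B j.+1 + A i.+1 :&: B j) = A i.+1 :&: B j.+1)%VS.
  rewrite -[RHS](addv_diff_cap _ (A i :&: B j.+1 + A i.+1 :&: B j)%VS).
  by congr (_ + _)%VS; rewrite (capv_idPr (smaller_sub i j)).
rewrite !subv_add sU //= IHi => [|a b ai bj]; last exact: sU (ltnW _) _.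
by rewrite IHj // => a b ai bj; apply: sU => //; apply: ltnW.
Qed.

Lemma dim_piece i j :
  (\dim (piece A B i j) + (\dim (A i :&: B j.+1) + \dim (A i.+1 :&: B j))
   = \dim (A i.+1 :&: B j.+1) + \dim (A i :&: B j))%N.
Proof.
rewrite -[in RHS](dimv_cap_compl (A i.+1 :&: B j.+1)%VS
  (A i :&: B j.+1 + A i.+1 :&: B j)%VS) (capv_idPr (smaller_sub i j)) -dimv_sum_cap.
rewrite addnCA addnA; congr (_ + \dim _)%N.
apply/eqP; rewrite eqEsubv !subv_cap capvSl capvSr /=.
rewrite (subv_trans (capvSl _ _) (capvSl _ _)).
rewrite (subv_trans (capvSr _ _) (capvSr _ _)).
by rewrite (subv_trans (capvSr _ _) (Bmono j)) (subv_trans (capvSl _ _) (Amono i)).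
Qed.

(** Telescoping of dim_piece in both indices. *)
Lemma sum_dim_pieces i j :
  (\sum_(a < i) \sum_(b < j) \dim (piece A B a b) = \dim (A i :&: B j))%N.
Proof.
elim: i => [|i IHi]; first by rewrite big_ord0 A0 cap0v dimv0.
rewrite big_ord_recr /= {}IHi.
elim: j => [|j IHj]; first by rewrite big_ord0 B0 !capv0 dimv0.
rewrite big_ord_recr /=; apply/eqP.
rewrite -(eqn_add2r (\dim (A i :&: B j))) -dim_piece -IHj.
by apply/eqP; ring.
Qed.

End OnePair.

(** The pieces span V and their dimensions add up to dim V, so V is their direct
    sum.  As the dimension of a piece is determined by those of the
    intersections, corresponding pieces are isomorphic, and the sum of such
    isomorphisms maps each intersection onto its counterpart. *)
Lemma adapted_iso n (A B A' B' : nat -> {vspace V}) :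
    A 0 = 0%VS -> B 0 = 0%VS -> A' 0 = 0%VS -> B' 0 = 0%VS ->
    (forall i, A i <= A i.+1)%VS -> (forall i, B i <= B i.+1)%VS ->
    (forall i, A' i <= A' i.+1)%VS -> (forall i, B' i <= B' i.+1)%VS ->
    A n = fullv -> B n = fullv -> A' n = fullv -> B' n = fullv ->
    (forall i j, \dim (A i :&: B j) = \dim (A' i :&: B' j)) ->
  exists2 g : 'End(V), lker g == 0%VS &
    forall i, (i <= n)%N -> (g @: A i)%VS = A' i /\ (g @: B i)%VS = B' i.
Proof.
move=> A0 B0 A'0 B'0 Am Bm A'm B'm An Bn A'n B'n dimE.
have dim_pieces i j : \dim (piece A B i j) = \dim (piece A' B' i j).
  have := dim_piece Am Bm i j; rewrite !dimE -(dim_piece A'm B'm).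
  by move/addIn.
pose Vs (p : 'I_n * 'I_n) := piece A B p.1 p.2.
have sumVs : fullv = (\sum_p Vs p)%VS.
  apply/eqP; rewrite eqEsubv subvf andbT -[X in (X <= _)%VS]capfv -{1}An -Bn.
  apply: cap_le_pieces => // a b an bn.
  exact: (sumv_sup (Ordinal an, Ordinal bn)).
have dxVs : directv (\sum_p Vs p).
  rewrite directvE /= -sumVs -[X in \dim X]capfv -{1}An -Bn.
  by rewrite -(sum_dim_pieces A0 B0 Am Bm) pair_bigA.
have phiP p := lfun_img_eqdim (dim_pieces (p : 'I_n * 'I_n).1 p.2).
have [phi phi_img] := choice phiP.
(* The isomorphisms phi p between the pieces, glued along the direct sum. *)
pose g : 'End(V) := \sum_p (phi p \o sumv_pi_for sumVs p)%VF.
have gE p v : v \in Vs p -> g v = phi p v.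
  move=> vp; pose us q := sumv_pi_for sumVs q v.
  have usq q : us q \in Vs q by apply: memv_sum_pi.
  have : \sum_q us q == \sum_q (if q == p then v else 0).
    by rewrite -big_mkcond big_pred1_eq (sumv_pi_sum sumVs) ?memvf.
  have /directv_sum_unique-> // := dxVs; last first.
    by move=> q _; case: eqP => [->|_]; rewrite ?mem0v.
  move/forallP=> usE; rewrite sum_lfunE (bigD1 p) //= lfunE /= big1 => [|q qp].
    by rewrite addr0; have /eqP := usE p; rewrite eqxx /us => ->.
  rewrite lfunE /=; have /eqP := usE q; rewrite (negPf qp) /us => ->.
  by rewrite linear0.
have g_img p : (g @: Vs p)%VS = piece A' B' p.1 p.2.
  rewrite -phi_img; apply: eq_in_limg => v; exact: gE.
have g_cap i j : (i <= n)%N -> (j <= n)%N ->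
    (A' i :&: B' j <= g @: (A i :&: B j))%VS.
  move=> le_i le_j; apply: cap_le_pieces => // a b ai bj.
  have := g_img (Ordinal (leq_trans ai le_i), Ordinal (leq_trans bj le_j)).
  by move=> /= <-; apply/limgS/piece_sub.
(* g maps V onto V, hence is injective. *)
have ker_g : lker g == 0%VS.
  have := g_cap n n (leqnn n) (leqnn n).
  rewrite An Bn A'n B'n !capfv => full_g.
  rewrite -dimv_eq0 -(eqn_add2r (\dim (limg g))) -{1}[lker g]capfv limg_ker_dim.
  by rewrite eq_sym eqn_leq dimvS ?subvf //= dimvS.
exists g => // i le_i.
have cap_eq a b : (a <= n)%N -> (b <= n)%N -> (g @: (A a :&: B b))%VS = (A' a :&: B' b)%VS.
  move=> le_a le_b; apply/esym/eqP; rewrite eqEdim g_cap //= -dimE.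
  by rewrite limg_dim_eq ?(eqP ker_g) ?capv0.
have := cap_eq i n le_i (leqnn n); rewrite Bn B'n !capvf => ->.
by have := cap_eq n i (leqnn n) le_i; rewrite An A'n !capfv => ->.
Qed.
End AdaptedIso.

(** * Orbits of pairs of flags *)

Section GLAction.
Variables (k : fieldType) (V : vectType k).
Implicit Types g h : GL V.

Definition mkGL (phi : 'End(V)) (ker_phi : lker phi == 0%VS) : GL V :=
  exist (fun phi => lker phi == 0%VS) phi ker_phi.

Lemma GL1_subproof : lker (\1%VF : 'End(V)) == 0%VS.
Proof. by apply/lker0P => u v; rewrite !id_lfunE. Qed.

Definition GL1 : GL V := mkGL GL1_subproof.

Lemma GLmul_subproof g h : lker (val g \o val h)%VF == 0%VS.
Proof.
apply/lker0P => u v; rewrite !comp_lfunE => /(lker0P (valP g)).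
exact: (lker0P (valP h)).
Qed.

Definition GLmul g h : GL V := mkGL (GLmul_subproof g h).

Lemma GLinv_subproof g : lker (val g)^-1%VF == 0%VS.
Proof.
by apply/lker0P => u v uv; rewrite -[u](lker0_lfunVK (valP g)) uv lker0_lfunVK ?(valP g).
Qed.

Definition GLinv g : GL V := mkGL (GLinv_subproof g).

Lemma dim_GL g (U : {vspace V}) : \dim (val g @: U)%VS = \dim U.
Proof. by rewrite limg_dim_eq // (eqP (valP g)) capv0. Qed.

Variable n : nat.
Implicit Types (f : flag V n) (p q : flag V n * flag V n).

Lemma actE g f i : val (act g f) i = (val g @: val f i)%VS.
Proof. by rewrite ffunE. Qed.

Lemma flag_ext f f' : (forall i, val f i = val f' i) -> f = f'.
Proof. by move=> ff'; apply/val_inj/ffunP. Qed.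

Lemma act1 f : act GL1 f = f.
Proof. by apply: flag_ext => i; rewrite actE /= lim1g. Qed.

Lemma actM g h f : act (GLmul g h) f = act g (act h f).
Proof. by apply: flag_ext => i; rewrite !actE /= limg_comp. Qed.

Lemma actK g f : act (GLinv g) (act g f) = f.
Proof.
by apply: flag_ext => i; rewrite !actE /= -limg_comp lker0_compVf ?lim1g ?(valP g).
Qed.

Lemma actVK g f : act g (act (GLinv g) f) = f.
Proof.
by apply: flag_ext => i; rewrite !actE /= -limg_comp lker0_compfV ?lim1g ?(valP g).
Qed.

Definition act2 g p := (act g p.1, act g p.2).

Lemma GLorbit_refl p : GLorbit p p.
Proof. by exists GL1; rewrite !act1; case: p. Qed.

Lemma GLorbit_act g p q : GLorbit p (act2 g q) <-> GLorbit p q.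
Proof.
split=> [[h e]|[h ->]]; last by exists (GLmul g h); rewrite !actM.
exists (GLmul (GLinv g) h); rewrite !actM.
rewrite -[act h p.1](congr1 fst e) -[act h p.2](congr1 snd e) /= !actK.
by case: q {e}.
Qed.

Lemma GLorbit_eq p q : GLorbit p q -> GLorbit q = GLorbit p.
Proof.
case=> g ->; apply/seteqP; split=> q'.
  by case=> h ->; exists (GLmul h g); rewrite !actM.
case=> h ->; exists (GLmul h (GLinv g)).
by rewrite !actM !actK.
Qed.

Lemma orbitP (X : orbit_type V n) p : val X p -> val X = GLorbit p.
Proof. by have /asboolP[q ->] := valP X => /GLorbit_eq ->. Qed.

Lemma orbit_act (X : orbit_type V n) g p : val X (act2 g p) <-> val X p.
Proof. by have /asboolP[q ->] := valP X; apply: GLorbit_act. Qed.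

Lemma orbit_subproof p : `[< exists q, GLorbit p = GLorbit q >].
Proof. by apply/asboolP; exists p. Qed.

Definition orb p : orbit_type V n :=
  exist (fun X => `[< exists q, X = GLorbit q >]) _ (orbit_subproof p).

Lemma orb_refl p : val (orb p) p. Proof. exact: GLorbit_refl. Qed.

Lemma orb_eq (X : orbit_type V n) p : val X p -> X = orb p.
Proof. by move=> Xp; apply/val_inj/orbitP. Qed.

Lemma orbit_ex (X : orbit_type V n) : exists p, val X p.
Proof. by have /asboolP[q ->] := valP X; exists q; apply: GLorbit_refl. Qed.

(** The subspaces of a flag indexed by all naturals, constant from n on: this
    makes inductions on the index free of side conditions. *)
Definition lev f (i : nat) : {vspace V} := val f (inord (minn i n)).

Lemma levE f (i : 'I_n.+1) : lev f i = val f i.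
Proof.
by rewrite /lev (minn_idPl _) ?inord_val // -ltnS.
Qed.

Lemma lev0 f : lev f 0 = 0%VS.
Proof. by have /and3P[/eqP f0 _ _] := valP f; rewrite (levE f ord0). Qed.

Lemma levn f : lev f n = fullv.
Proof. by have /and3P[_ /eqP fn _] := valP f; rewrite (levE f ord_max). Qed.

Lemma lev_mono f i : (lev f i <= lev f i.+1)%VS.
Proof.
have [lt_in|le_ni] := ltnP i n; last first.
  by rewrite /lev (minn_idPr le_ni) (minn_idPr (leqW le_ni)).
have /and3P[_ _ /forallP/(_ (Ordinal lt_in))] := valP f.
by rewrite -!levE /= /bump add1n.
Qed.

Lemma conj_flags p q :
    (forall i j, \dim (val p.1 i :&: val p.2 j) = \dim (val q.1 i :&: val q.2 j)) ->
  GLorbit p q.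
Proof.
move=> dimE; have := @adapted_iso k V n (lev p.1) (lev p.2) (lev q.1) (lev q.2).
case; rewrite ?lev0 ?levn //; try exact: lev_mono.
  by move=> i j; apply: dimE.
move=> g ker_g gE; exists (mkGL ker_g).
case: q dimE gE => q1 q2 dimE gE; congr (_, _); apply: flag_ext => i;
  by rewrite actE /= -!levE; have [] := gE i (leq_ord i).
Qed.

(** Sums are preferred to intersections because the dimension of a sum of images
    is lower semicontinuous, so that the large values are the generic ones. *)
Definition rho p (i j : 'I_n.+1) := \dim (val p.1 i + val p.2 j).

Lemma rho_act g p : rho (act2 g p) =2 rho p.
Proof. by move=> i j; rewrite /rho /= !actE -limgD dim_GL. Qed.

Lemma rho_le p i j : (rho p i j <= \dim {:V})%N.
Proof. exact: dimvS (subvf _). Qed.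

(** The dimensions in each flag are recovered from the entries with j = 0 or i = 0,
    where one summand vanishes; so rho determines the dimensions of the
    intersections. *)
Lemma rho_orbit p q : rho p =2 rho q -> GLorbit p q.
Proof.
move=> rhoE.
have flag0 f : val f ord0 = 0%VS by rewrite -(levE f ord0) lev0.
have dim1 i : \dim (val p.1 i) = \dim (val q.1 i).
  by have := rhoE i ord0; rewrite /rho !flag0 !addv0.
have dim2 i : \dim (val p.2 i) = \dim (val q.2 i).
  by have := rhoE ord0 i; rewrite /rho !flag0 !add0v.
apply: conj_flags => i j; apply/eqP; rewrite -(eqn_add2l (rho p i j)) {2}rhoE /rho.
by rewrite !dimv_sum_cap dim1 dim2.
Qed.

Lemma jump_act g f : jump (act g f) =1 jump f.
Proof. by move=> i; rewrite /jump !actE !dim_GL. Qed.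

(** GL(V) is transitive on flags with given jumps: conjugate the pairs (f, f) and
    (f', f'), whose intersections are terms of the flags. *)
Lemma jump_orbit f f' : jump f =1 jump f' -> exists g, f' = act g f.
Proof.
move=> jE.
have dim_lev i : \dim (lev f i) = \dim (lev f' i).
  elim: i => [|i IHi]; first by rewrite !lev0.
  have [lt_in|le_ni] := ltnP i n; last first.
    by move: IHi; rewrite /lev !(minn_idPr le_ni) !(minn_idPr (leqW le_ni)).
  have := jE (Ordinal lt_in); rewrite /jump -!levE /= /bump add1n /= => jEi.
  rewrite -[LHS](subnK (dimvS (lev_mono f i))) jEi IHi.
  exact: (subnK (dimvS (lev_mono f' i))).
have lev_le (f0 : flag V n) i j : (i <= j)%N -> (lev f0 i <= lev f0 j)%VS.
  elim: j => [|j IHj]; first by rewrite leqn0 => /eqP->.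
  rewrite leq_eqVlt => /predU1P[-> //|ij]; exact: subv_trans (IHj ij) (lev_mono _ j).
have [] // := @conj_flags (f, f) (f', f').
  move=> i j /=; rewrite -!levE; have [ij|ji] := leqP i j.
    by rewrite !(capv_idPl _) ?lev_le.
  by rewrite !(capv_idPr _) ?lev_le // ltnW.
by move=> g /(congr1 fst) /= ->; exists g.
Qed.

End GLAction.

(** * Zariski open conditions on pairs of endomorphisms *)

Section ZariskiGL.
Local Open Scope classical_set_scope.
Variables (k : fieldType) (V : vectType k).
Implicit Types (q : {mpoly k[\dim {:End2 V}]}) (x d : End2 V).

Definition End2_coords x : 'I_(\dim {:End2 V}) -> k :=
  fun i => coord (vbasis {:End2 V}) i x.

Definition polyfun (F : End2 V -> k) := exists q, forall x, F x = q.@[End2_coords x].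

Lemma polyfun_linear (F : {linear End2 V -> k^o}) : polyfun F.
Proof.
exists (\sum_(i < \dim {:End2 V}) (F (vbasis {:End2 V})`_i : k) *: 'X_i) => x.
rewrite {1}(coord_vbasis (memvf x)) linear_sum raddf_sum; apply: eq_bigr => i _.
by rewrite linearZ /= mevalZ mevalXU mulrC.
Qed.

Lemma polyfun_det m (M : End2 V -> 'M[k]_m) :
  (forall i j, polyfun (fun x => M x i j)) -> polyfun (fun x => \det (M x)).
Proof.
move=> polyM.
have [Q QE] := choice (fun ij : 'I_m * 'I_m => polyM ij.1 ij.2).
exists (\det (\matrix_(i, j) Q (i, j))) => x.
rewrite -[RHS]det_map_mx; congr (\det _); apply/matrixP => i j.
by rewrite !mxE (QE (i, j)).
Qed.

(** Lower semicontinuity of the rank.  Write a basis e of phi0 U + psi0 W as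
    phi0 u_i + psi0 w_i; then q is the determinant of the coordinates, with
    respect to e, of the vectors phi u_i + psi w_i.  It is 1 at (phi0, psi0), and
    where it does not vanish these vectors are independent. *)
Lemma dim_add_img_lsc (U W : {vspace V}) (phi0 psi0 : 'End(V)) :
  exists2 q, q.@[End2_coords (phi0, psi0)] != 0 &
    forall phi psi : 'End(V), q.@[End2_coords (phi, psi)] != 0 ->
      (\dim (phi0 @: U + psi0 @: W) <= \dim (phi @: U + psi @: W))%N.
Proof.
set Y0 := (phi0 @: U + psi0 @: W)%VS; pose e := vbasis Y0.
have uwP (i : 'I_(\dim Y0)) : exists uw : V * V,
    [/\ uw.1 \in U, uw.2 \in W & e`_i = phi0 uw.1 + psi0 uw.2].
  have /memv_addP[_ /memv_imgP[u uU ->] [_ /memv_imgP[w wW ->] ->]] : e`_i \in Y0.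
    by apply/vbasis_mem/mem_nth; rewrite size_tuple.
  by exists (u, w).
have [uw uwE] := choice uwP.
pose X (x : End2 V) := [tuple x.1 (uw i).1 + x.2 (uw i).2 | i < \dim Y0].
pose M (x : End2 V) := \matrix_(i, j) coord e j (tnth (X x) i).
have [q qE] : polyfun (fun x => \det (M x)).
  apply: polyfun_det => i j.
  pose F (x : End2 V) : k^o := coord e j (x.1 (uw i).1 + x.2 (uw i).2).
  have linF : linear F.
    move=> a x y; rewrite /F -[RHS](linearP (coord e j)) /=; congr (coord e j _).
    by rewrite !lfunE /= !lfunE /= scalerDr addrACA.
  pose FL : {linear End2 V -> k^o} := HB.pack F (GRing.isLinear.Build _ _ _ _ F linF).
  have [q qE] := polyfun_linear FL; exists q => x.
  by rewrite -qE mxE tnth_mktuple.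
exists q => [|phi psi]; rewrite -qE.
  suff -> : M (phi0, psi0) = 1%:M by rewrite det1 oner_neq0.
  apply/matrixP => i j; rewrite !mxE tnth_mktuple /=.
  have [_ _ <-] := uwE i.
  exact: (coord_free i j (basis_free (vbasisP Y0))).
move=> detM; have freeX : free (X (phi, psi)).
  apply/freeP => c sum0.
  have: (\row_i c i) *m M (phi, psi) = 0.
    apply/rowP => j; rewrite !mxE -[RHS](linear0 (coord e j)) -sum0 linear_sum.
    by apply: eq_bigr => i _; rewrite !mxE (tnth_nth 0) linearZ.
  move=> /(congr1 (mulmx^~ (invmx (M (phi, psi))))).
  rewrite mulmxK ?unitmxE ?unitfE // mul0mx => c0 i.
  by have /rowP/(_ i) := c0; rewrite !mxE.
have /eqP dimX : \dim <<X (phi, psi)>> == size (X (phi, psi)) by [].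
rewrite -{1}(size_tuple (X (phi, psi))) -dimX; apply/dimvS/span_subvP => v.
case/tnthP=> i ->; rewrite tnth_mktuple /=; have [uU wW _] := uwE i.
by rewrite memv_add ?memv_img.
Qed.

Lemma poly_line q x d : exists P : {poly k},
  forall t, P.[t] = q.@[End2_coords (x + t *: d)].
Proof.
exists (mmap polyC (fun i => (End2_coords x i)%:P + (End2_coords d i) *: 'X) q) => t.
rewrite mevalE /mmap horner_sum; apply: eq_bigr => m _.
rewrite hornerM hornerC; congr (_ * _); rewrite /mmap1 horner_prod.
apply: eq_bigr => i _; rewrite !hornerE /End2_coords linearD linearZ /=.
by rewrite [t * _]mulrC.
Qed.

(** Open sets are the unions of the principal open sets they contain. *)
Lemma GL2_openP (Y : set (GL V * GL V)) : GL2_open Y <->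
  forall gh, Y gh -> exists2 q, q.@[coords gh] != 0 &
                       forall gh', q.@[coords gh'] != 0 -> Y gh'.
Proof.
split=> [[I ->] gh /= | Yloc].
  move=> /existsNP[q /not_implyP[Iq /eqP q0]]; exists q => // gh' q'0 /(_ q Iq).
  exact/eqP.
(* The complement of Y is cut out by all the polynomials vanishing on it. *)
exists [set q | forall gh, q.@[coords gh] != 0 -> Y gh].
apply/seteqP; split=> [gh Ygh /= /(_ _ _)|gh /= /existsNP[q /not_implyP[Iq /eqP]]].
  by have [q q0 qY] := Yloc gh Ygh => /(_ q qY) /eqP; apply/negP.
exact: Iq.
Qed.

Variable n : nat.

Lemma rho_open (m : 'I_n.+1 -> 'I_n.+1 -> nat) :
  zariski_open [set p : flag V n * flag V n | forall i j, (m i j <= rho p i j)%N].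
Proof.
move=> p; apply/GL2_openP => gh /= mgh.
have QP (ij : 'I_n.+1 * 'I_n.+1) : exists q, q.@[coords gh] != 0 /\
    forall gh', q.@[coords gh'] != 0 ->
      (rho (act gh.1 p.1, act gh.2 p.2) ij.1 ij.2
       <= rho (act gh'.1 p.1, act gh'.2 p.2) ij.1 ij.2)%N.
  have [q q0 qle] :=
    dim_add_img_lsc (val p.1 ij.1) (val p.2 ij.2) (val gh.1) (val gh.2).
  exists q; split=> // gh' q'0; rewrite /rho /= !actE; exact: qle.
have [Q QE] := choice QP.
exists (\prod_ij Q ij) => [|gh']; rewrite rmorph_prod.
  by apply/prodf_neq0 => ij _; have [] := QE ij.
move=> /prodf_neq0 Q'0 i j; apply: leq_trans (mgh i j) _.
by have [_] := QE (i, j); apply; apply: Q'0.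
Qed.

End ZariskiGL.

(** * Irreducibility of stabilisers *)

Section StabiliserLine.
Local Open Scope classical_set_scope.
Variables (k : closedFieldType) (V : vectType k) (n : nat).
Implicit Types (b : flag V n) (g h : GL V).

Lemma act_stabP b (phi : 'End(V)) (ker_phi : lker phi == 0%VS) :
  (forall i, phi @: val b i <= val b i)%VS -> act (mkGL ker_phi) b = b.
Proof.
move=> phi_b; apply: flag_ext => i; apply/eqP.
by rewrite eqEdim actE phi_b /= -(dim_GL (mkGL ker_phi)).
Qed.

(** Two nonempty open conditions on the stabiliser of b, one satisfied by 1 and
    one by h, hold simultaneously somewhere.  On the line 1 + t (h - 1), the
    first holds at t = 0 and the second at t = 1, so both hold for all but
    finitely many t; so does invertibility.  Every point of the line maps each
    term of b into itself. *)
Lemma stab_generic b h u v (U W : set (flag V n * flag V n)) :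
    act h b = b -> zariski_open U -> zariski_open W ->
    U u -> W (v.1, act h v.2) ->
  exists h', [/\ act h' b = b, U (u.1, act h' u.2) & W (v.1, act h' v.2)].
Proof.
move=> hb Uop Wop Uu Wv.
have /GL2_openP/(_ (GL1 V, GL1 V)) := Uop u; rewrite /= !act1 -surjective_pairing.
move=> /(_ Uu)[q1 q1n0 q1U].
have /GL2_openP/(_ (GL1 V, h)) := Wop v; rewrite /= !act1.
move=> /(_ Wv)[q2 q2n0 q2W].
(* The polynomial q3 detects the invertibility of the second component. *)
have [q3 q3n0 q3inj] := dim_add_img_lsc 0%VS fullv (\1%VF : 'End(V)) (\1%VF : 'End(V)).
pose x : End2 V := (\1%VF, \1%VF); pose d : End2 V := (0, val h - \1%VF).
have lineE t : x + t *: d = (\1%VF, \1%VF + t *: (val h - \1%VF)).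
  by congr (_, _); rewrite /= scaler0 addr0.
have [P1 P1E] := poly_line q1 x d; have [P2 P2E] := poly_line q2 x d.
have [P3 P3E] := poly_line q3 x d.
have x0 : x + 0 *: d = x by rewrite scale0r addr0.
have x1 : x + 1 *: d = (\1%VF, val h) by rewrite lineE scale1r addrC subrK.
have neq0 (P : {poly k}) t : P.[t] != 0 -> P != 0.
  by apply: contraNneq => ->; rewrite horner0.
have : P1 * P2 * P3 != 0.
  by rewrite !mulf_neq0 //; first 1 [apply: (@neq0 P1 0) | apply: (@neq0 P2 1)
    | apply: (@neq0 P3 0)]; rewrite ?P1E ?P2E ?P3E ?x0 ?x1.
move=> /closed_nonrootP[t]; rewrite !rootM !negb_or /root P1E P2E P3E lineE.
set psi := \1%VF + _ => /andP[/andP[psi1 psi2] psi3].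
have ker_psi : lker psi == 0%VS.
  have := q3inj _ psi psi3; rewrite !limg0 !add0v lim1g => full.
  rewrite -dimv_eq0 -(eqn_add2r (\dim (limg psi))).
  rewrite -{1}[lker psi]capfv limg_ker_dim add0n eqn_leq full /=.
  exact/dimvS/subvf.
exists (mkGL ker_psi); split.
- apply: act_stabP => i; apply/subvP => _ /memv_imgP[w wb ->].
  have hw : val h w \in val b i by rewrite -hb actE memv_img.
  rewrite add_lfunE scale_lfunE add_lfunE opp_lfunE id_lfunE.
  by rewrite rpredD ?rpredZ ?rpredB.
- by have := q1U (GL1 V, mkGL ker_psi) psi1; rewrite act1.
- by have := q2W (GL1 V, mkGL ker_psi) psi2; rewrite /= act1.
Qed.

End StabiliserLine.

(** * The product of orbits *)

Section OpenOrbit.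
Local Open Scope classical_set_scope.
Variables (k : closedFieldType) (V : vectType k) (n : nat).
Implicit Types (X Y Z : orbit_type V n) (p q z : flag V n * flag V n).
Implicit Types (S U : set (flag V n * flag V n)).

(** A set need not contain such a z; when it does, rho_orbit shows that the
    orbit of z is determined by S. *)
Definition generic_in S z :=
  S z /\ forall p, S p -> forall i j, (rho p i j <= rho z i j)%N.

Lemma generic_orbit S z p : generic_in S z -> S p ->
  (forall i j, (rho z i j <= rho p i j)%N) -> orb p = orb z.
Proof.
move=> [Sz zmax] Sp zp; apply/esym/orb_eq/rho_orbit => i j.
by apply/eqP; rewrite eqn_leq zmax ?zp.
Qed.

Lemma orbit_pair_conj X (a b a' b' : flag V n) : val X (a, b) -> val X (a', b') ->
  exists g, a' = act g a /\ b' = act g b.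
Proof.
move=> Xab; rewrite (orbitP Xab) => -[g /= e]; exists g.
by split; [apply: (congr1 fst e) | apply: (congr1 snd e)].
Qed.

Lemma comp_set_act X Y g p : comp_set X Y p -> comp_set X Y (act2 g p).
Proof.
move=> [f [Xf Yf]]; exists (act g f).
by split; [apply: (orbit_act X g (p.1, f)).2 | apply: (orbit_act Y g (f, p.2)).2].
Qed.

Lemma comp_set_stab X Y b h p : act h b = b ->
  val X (p.1, b) -> val Y (b, p.2) -> comp_set X Y (p.1, act h p.2).
Proof.
move=> hb Xb Yb; exists b; split=> //=.
by rewrite -{1}hb; apply: (orbit_act Y h (b, p.2)).2.
Qed.

(** Move the intermediate flag of q back to b: what is left is an element of the
    stabiliser of b acting on the second flag. *)
Lemma comp_set_pair X Y b p q :
    val X (p.1, b) -> val Y (b, p.2) -> comp_set X Y q ->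
  exists g h, act h b = b /\ q = act2 g (p.1, act h p.2).
Proof.
move=> Xb Yb [b' [Xb' Yb']].
have [g [q1E b'E]] := orbit_pair_conj Xb Xb'.
have [h [b'E' q2E]] := orbit_pair_conj Yb Yb'.
exists g, (GLmul (GLinv g) h); rewrite !actM -b'E' {1}b'E actK; split=> //.
by case: q q1E q2E {Xb' Yb'} => q1 q2 /= -> ->; rewrite /act2 /= actVK.
Qed.

(** A nonempty open subset of S(X, Y) meets the set of pairs whose rho is at least
    that of q. *)
Lemma comp_set_irreducible X Y U p q :
    zariski_open U -> comp_set X Y p -> U p -> comp_set X Y q ->
  exists z, [/\ comp_set X Y z, U z & forall i j, (rho q i j <= rho z i j)%N].
Proof.
move=> Uop [b [Xb Yb]] Up Sq.
have [g [h [hb qE]]] := comp_set_pair Xb Yb Sq.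
have rho_q i j : (rho q i j <= rho (p.1, act h p.2) i j)%N by rewrite qE rho_act.
have [h' [h'b Uz qz]] := stab_generic hb Uop (rho_open (rho q)) Up rho_q.
by exists (p.1, act h' p.2); split=> //; apply: (comp_set_stab h'b Xb Yb).
Qed.

(** Take z with the largest sum of all the rho_ij.  By irreducibility, for every q
    there is y dominating both z and q; maximality forces y to have the same rho
    as z, so z dominates q. *)
Lemma generic_exists X Y p : comp_set X Y p -> exists z, generic_in (comp_set X Y) z.
Proof.
move=> Sp; pose w q := (\sum_i \sum_j rho q i j)%N.
pose P m := `[< exists2 q, comp_set X Y q & w q = m >].
have exP : exists m, P m by exists (w p); apply/asboolP; exists p.
have bndP m : P m -> (m <= \sum_(i < n.+1) \sum_(j < n.+1) \dim {:V})%N.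
  by move=> /asboolP[q _ <-]; do 2!apply: leq_sum => ? _; apply: rho_le.
have [m /asboolP[z Sz <-] mmax] := ex_maxnP exP bndP.
exists z; split=> // q Sq i j.
have [y [Sy zy qy]] := comp_set_irreducible (rho_open (rho z)) Sz (fun _ _ => leqnn _) Sq.
have wy : (w y <= w z)%N by apply: mmax; apply/asboolP; exists y.
apply: leq_trans (qy i j) _; rewrite leqNgt; apply: contraTN wy => lt_ij.
rewrite -ltnNge /w (bigD1 i) //= [ltnRHS](bigD1 i) //= -addSn leq_add //.
  rewrite (bigD1 j) //= [ltnRHS](bigD1 j) //= -addSn leq_add //.
  by apply: leq_sum => j' _; apply: zy.
by apply: leq_sum => i' _; apply: leq_sum => j' _; apply: zy.
Qed.

(** The orbit of z is cut out in S(X, Y) by the open condition rho >= rho z.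
    Conversely any open orbit Z meets the locus rho >= rho z, by irreducibility,
    hence is the orbit of z. *)
Lemma open_orbit_generic X Y z :
  generic_in (comp_set X Y) z -> open_orbit (comp_set X Y) = Some (orb z).
Proof.
move=> gen_z; have [Sz zmax] := gen_z; apply: xget_unique => [|_ [Z -> [ZS [U Uop ZE]]]].
  exists (orb z) => //; split=> [_ [g ->]|]; first exact: comp_set_act.
  exists [set p | forall i j, (rho z i j <= rho p i j)%N]; first exact: rho_open.
  apply/seteqP; split=> [_ [g ->]|p [zp Sp]] /=.
    by split; [move=> i j; rewrite rho_act | apply: comp_set_act].
  by have := orb_refl p; rewrite (generic_orbit gen_z Sp zp).
have [p Zp] := orbit_ex Z.
have [Up Sp] : (U `&` comp_set X Y) p by rewrite -ZE.
have [y [Sy Uy zy]] := comp_set_irreducible Uop Sp Up Sz.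
rewrite -(generic_orbit gen_z Sy zy); congr Some; apply: orb_eq.
by rewrite ZE.
Qed.

Lemma open_orbit0 S : (forall p, ~ S p) -> open_orbit S = None.
Proof.
move=> S0; apply: xgetPN => oZ [Z _ [ZS _]].
by have [p /ZS] := orbit_ex Z; apply: S0.
Qed.

Definition orbit_mul X Y := open_orbit (comp_set X Y).

Lemma orbit_mul_generic X Y p : comp_set X Y p ->
  exists2 z, generic_in (comp_set X Y) z & orbit_mul X Y = Some (orb z).
Proof.
by move=> /generic_exists[z gen_z]; exists z => //; apply: open_orbit_generic.
Qed.

Lemma orbit_mul_sub X Y Z : orbit_mul X Y = Some Z -> val Z `<=` comp_set X Y.
Proof.
have [[p Sp]|/forallNP S0] := pselect (exists p, comp_set X Y p); last first.
  by rewrite /orbit_mul open_orbit0.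
have [z [Sz _] ->] := orbit_mul_generic Sp; case=> <- _ [g ->]; exact: comp_set_act.
Qed.

Definition comp_set3 X Y Z : set (flag V n * flag V n) :=
  [set p | exists f f', [/\ val X (p.1, f), val Y (f, f') & val Z (f', p.2)]].

(** Given q with intermediate flags a and a', move a' and the second flag of q by
    the same element h' of the stabiliser of a.  The result is still linked by
    two intermediate flags; for generic h' the pair (q.1, h' a') lies in X * Y,
    while rho has not decreased on the outer pair.  So a pair generic in
    S(X * Y, Z) dominates every q. *)
Lemma orbit_mul3l X Y Z p : comp_set3 X Y Z p ->
  exists2 z, generic_in (comp_set3 X Y Z) z &
             obind (orbit_mul^~ Z) (orbit_mul X Y) = Some (orb z).
Proof.
move=> [f [f' [Xf Yf Zf']]].
have XYp : comp_set X Y (p.1, f') by exists f.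
have [x [XYx xmax] ->] := orbit_mul_generic XYp => /=.
have max_p (q : flag V n * flag V n) : comp_set3 X Y Z q ->
  exists2 y, comp_set (orb x) Z y & forall i j, (rho q i j <= rho y i j)%N.
  move=> [a [a' [Xa Ya Za']]].
  have [g [h [ha xE]]] := comp_set_pair (p := (q.1, a')) Xa Ya XYx.
  have rho_x i j : (rho x i j <= rho (q.1, act h a') i j)%N by rewrite xE rho_act.
  have [h' [h'a qh' xh']] := stab_generic (u := q) (v := (q.1, a')) ha
    (rho_open (rho q)) (rho_open (rho x)) (fun _ _ => leqnn _) rho_x.
  exists (q.1, act h' q.2) => //; exists (act h' a'); split.
    have S' := comp_set_stab (p := (q.1, a')) h'a Xa Ya.
    by have := orb_refl (q.1, act h' a'); rewrite (generic_orbit (conj XYx xmax) S' xh').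
  exact: (orbit_act Z h' (a', q.2)).2.
have [y Sy _] := max_p p (ex_intro _ f (ex_intro _ f' (And3 Xf Yf Zf'))).
have [z [Sz zmax] ->] := orbit_mul_generic Sy; exists z => //; split.
  have [b [xb Zb]] := Sz.
  have [a [Xa Ya]] : comp_set X Y (z.1, b).
    by case: xb => h ->; apply: comp_set_act.
  by exists a, b.
by move=> q /max_p[y' /zmax zy' qy'] i j; apply: leq_trans (qy' i j) (zy' i j).
Qed.

(** As in orbit_mul3l, moving only the second flag of q, by the stabiliser of its
    second intermediate flag. *)
Lemma orbit_mul3r X Y Z p : comp_set3 X Y Z p ->
  exists2 z, generic_in (comp_set3 X Y Z) z &
             obind (orbit_mul X) (orbit_mul Y Z) = Some (orb z).
Proof.
move=> [f [f' [Xf Yf Zf']]].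
have YZp : comp_set Y Z (f, p.2) by exists f'.
have [x [YZx xmax] ->] := orbit_mul_generic YZp => /=.
have max_p (q : flag V n * flag V n) : comp_set3 X Y Z q ->
  exists2 y, comp_set X (orb x) y & forall i j, (rho q i j <= rho y i j)%N.
  move=> [a [a' [Xa Ya Za']]].
  have [g [h [ha xE]]] := comp_set_pair (p := (a, q.2)) Ya Za' YZx.
  have rho_x i j : (rho x i j <= rho (a, act h q.2) i j)%N by rewrite xE rho_act.
  have [h' [h'a qh' xh']] := stab_generic (u := q) (v := (a, q.2)) ha
    (rho_open (rho q)) (rho_open (rho x)) (fun _ _ => leqnn _) rho_x.
  exists (q.1, act h' q.2) => //; exists a; split=> //.
  have S' := comp_set_stab (p := (a, q.2)) h'a Ya Za'.
  by have := orb_refl (a, act h' q.2); rewrite (generic_orbit (conj YZx xmax) S' xh').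
have [y Sy _] := max_p p (ex_intro _ f (ex_intro _ f' (And3 Xf Yf Zf'))).
have [z [Sz zmax] ->] := orbit_mul_generic Sy; exists z => //; split.
  have [b [Xb xb]] := Sz.
  have [a [Ya Za]] : comp_set Y Z (b, z.2).
    by case: xb => h ->; apply: comp_set_act.
  by exists b, a.
by move=> q /max_p[y' /zmax zy' qy'] i j; apply: leq_trans (qy' i j) (zy' i j).
Qed.

(** Both sides are the orbit of a pair dominating the set of pairs linked by two
    intermediate flags; if that set is empty, both products vanish. *)
Lemma orbit_mulA X Y Z :
  obind (orbit_mul^~ Z) (orbit_mul X Y) = obind (orbit_mul X) (orbit_mul Y Z).
Proof.
have [[p Sp]|/forallNP S0] := pselect (exists p, comp_set3 X Y Z p).
  have [x [Sx xmax] ->] := orbit_mul3l Sp; have [y gen_y ->] := orbit_mul3r Sp.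
  by congr Some; apply: (generic_orbit gen_y Sx) => i j; apply: xmax; case: gen_y.
have -> : obind (orbit_mul^~ Z) (orbit_mul X Y) = None.
  case XY: (orbit_mul X Y) => [x|] //=; apply: open_orbit0 => p [b [/(orbit_mul_sub XY)]].
  by case=> a [Xa Ya] Zb; apply: (S0 p); exists a, b.
case YZ: (orbit_mul Y Z) => [x|] //=; apply/esym/open_orbit0 => p [b [Xb]].
by case/(orbit_mul_sub YZ)=> a [Ya Za]; apply: (S0 p); exists b, a.
Qed.

End OpenOrbit.

(** * The algebra G(n, r) *)

Section GenericAlgebra.
Local Open Scope classical_set_scope.
Variables (k : closedFieldType) (V : vectType k) (n : nat).
Implicit Types (X Y Z : orbit_type V n) (x y z : Gnr V n).

Lemma int_scale_ind (M : lmodType int) (P : M -> Prop) (c : int) v :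
  P 0 -> (forall u w, P u -> P w -> P (u - w)) -> P v -> P (c *: v).
Proof.
move=> P0 PB Pv; have PN u : P u -> P (- u) by move=> Pu; rewrite -sub0r; apply: PB.
have Pn m : P (v *+ m).
  elim: m => [|m IHm]; first by rewrite mulr0n.
  by rewrite mulrS -[v *+ m]opprK; apply/PB/PN.
rewrite -[c]intz scaler_int; case: c => m; first exact: Pn.
by rewrite NegzE mulrNz; apply/PN/Pn.
Qed.

Lemma Gnr_ind (P : Gnr V n -> Prop) :
    P 0 -> (forall x y, P x -> P y -> P (x - y)) -> (forall X, P (e_orb X)) ->
  forall x, P x.
Proof.
move=> P0 PB Pe x; have PD u v : P u -> P v -> P (u + v).
  by move=> Pu Pv; rewrite -[v]opprK; apply: (PB) => //; rewrite -sub0r; apply: PB.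
rewrite -[x]freeg_sumE; elim/big_ind: _ => // X _.
have -> : << coeff X x *g X >> = coeff X x *: e_orb X :> Gnr V n.
  by rewrite -[in RHS](intz (coeff X x)) scaler_int freegU_mulz intz.
exact: int_scale_ind.
Qed.

Lemma fglift_e (M : lmodType int) (f : orbit_type V n -> M) X : fglift f (e_orb X) = f X.
Proof. by rewrite liftU scale1r. Qed.

Lemma starBl x y z : star (x - y) z = star x z - star y z.
Proof. exact: lift_is_additive. Qed.

Lemma starBr x y z : star z (x - y) = star z x - star z y.
Proof.
have star0 (u : Gnr V n) : star 0 u = 0 by have := starBl 0 0 u; rewrite !subrr.
elim/Gnr_ind: z => [|u v IHu IHv|X]; first by rewrite !star0 subrr.
  by rewrite !starBl IHu IHv !opprB [star v y - _]addrC addrACA [- _ + _]addrC.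
by rewrite /star !fglift_e; apply: lift_is_additive.
Qed.

Lemma star0l z : star 0 z = 0.
Proof. by have := starBl 0 0 z; rewrite !subrr. Qed.

Lemma star0r z : star z 0 = 0.
Proof. by have := starBr 0 0 z; rewrite !subrr. Qed.

Lemma starDl x y z : star (x + y) z = star x z + star y z.
Proof. by rewrite -[y in LHS]opprK starBl -sub0r starBl star0l sub0r opprK. Qed.

Lemma starDr x y z : star z (x + y) = star z x + star z y.
Proof. by rewrite -[y in LHS]opprK starBr -sub0r starBr star0r sub0r opprK. Qed.

Lemma star_suml (I : finType) (F : I -> Gnr V n) z :
  star (\sum_i F i) z = \sum_i star (F i) z.
Proof. exact: (big_morph _ (fun x y => starDl x y z) (star0l z)). Qed.

Lemma star_sumr (I : finType) (F : I -> Gnr V n) z :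
  star z (\sum_i F i) = \sum_i star z (F i).
Proof. exact: (big_morph _ (fun x y => starDr x y z) (star0r z)). Qed.

Lemma star_e X Y : star (e_orb X) (e_orb Y) = e_opt (orbit_mul X Y).
Proof. by rewrite /star !fglift_e. Qed.

Lemma starA : associative (@star k V n).
Proof.
move=> x y z; elim/Gnr_ind: x => [|u v IHu IHv|X]; first by rewrite !star0l.
  by rewrite !starBl IHu IHv.
elim/Gnr_ind: y => [|u v IHu IHv|Y]; first by rewrite star0r !star0l star0r.
  by rewrite !(starBl, starBr) IHu IHv.
elim/Gnr_ind: z => [|u v IHu IHv|Z]; first by rewrite !star0r.
  by rewrite !starBr IHu IHv.
rewrite !star_e; have := orbit_mulA X Y Z.
have el oX : star (e_opt oX) (e_orb Z) = e_opt (obind (fun W => orbit_mul W Z) oX).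
  by case: oX => [W|]; rewrite /= ?star_e ?star0l.
have er oX : star (e_orb X) (e_opt oX) = e_opt (obind (orbit_mul X) oX).
  by case: oX => [W|]; rewrite /= ?star_e ?star0r.
by rewrite el er => ->.
Qed.

Variable r : nat.
Hypothesis hV : \dim {:V} = r.
Implicit Types (d e : Dnr n r) (f : flag V n).

Lemma Fl_exists f : exists d : Dnr n r, Fl d f.
Proof.
have sum_jump : (\sum_(i < n) jump f i = r)%N.
  have := @telescope_sumn_in 0 n (fun i => \dim (lev f i)) (leq0n n)
    (fun i _ => dimvS (lev_mono f i)).
  rewrite lev0 levn dimv0 subn0 hV big_mkord => <-; apply: eq_bigr => i _.
  by rewrite /jump -!levE /= /bump add1n.
have jump_le i : (jump f i < r.+1)%N.
  by rewrite ltnS -sum_jump (bigD1 i) //= leq_addr.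
pose t := [tuple Ordinal (jump_le i) | i < n].
have sum_t : (\sum_(i < n) tnth t i)%N == r.
  by rewrite -[X in _ == X]sum_jump; apply/eqP/eq_bigr => i _; rewrite tnth_mktuple.
by exists (exist _ t sum_t) => i /=; rewrite tnth_mktuple.
Qed.

Lemma Fl_inj d e f : Fl d f -> Fl e f -> d = e.
Proof.
move=> df ef; apply/val_inj/eq_from_tnth => i; apply/val_inj.
by rewrite /= -df -ef.
Qed.

Lemma Fl_act d g f : Fl d f -> Fl d (act g f).
Proof. by move=> df i; rewrite jump_act. Qed.

Lemma Fl_trans d f f' : Fl d f -> Fl d f' -> exists g, f' = act g f.
Proof. by move=> df df'; apply: jump_orbit => i; rewrite df df'. Qed.

Lemma orbit_Fl X (p : flag V n * flag V n) d e :
  val X p -> Fl d p.1 -> Fl e p.2 -> val X `<=` Fl d `*` Fl e.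
Proof. by move=> /orbitP-> df ef' _ [g ->]; split; apply: Fl_act. Qed.

Lemma orbit_mul_mismatch X Y d d' e e' :
  val X `<=` Fl d `*` Fl d' -> val Y `<=` Fl e `*` Fl e' ->
  d' <> e -> orbit_mul X Y = None.
Proof.
move=> Xd Ye de; apply: open_orbit0 => p [f [/Xd[/= _ d'f] /Ye[/= ef _]]].
exact/de/(Fl_inj d'f ef).
Qed.

Hypothesis hn : (0 < n)%N.

(** * The ideal M(n, r) *)

Lemma triv_flag_subproof :
  is_flag [ffun i : 'I_n.+1 => if i == ord0 then 0%VS else {:V}%VS].
Proof.
have max_neq0 : ((ord_max : 'I_n.+1) == ord0) = false.
  by apply/eqP => /(congr1 val) /= n0; move: hn; rewrite n0.
rewrite /is_flag !ffunE max_neq0 !eqxx /=.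
by apply/forallP => i; rewrite !ffunE /= subvf.
Qed.

Definition triv_flag : flag V n := Sub _ triv_flag_subproof.

Lemma act_triv g : act g triv_flag = triv_flag.
Proof.
apply: flag_ext => i; rewrite actE ffunE; case: ifP => _; first by rewrite limg0.
by rewrite lker0_limgf ?(valP g).
Qed.

(** Since GL(V) fixes the flag 0, V, ..., V, going through it imposes no relation
    between the outer flags. *)
Lemma comp_set_triv (f f' : flag V n) d e : Fl d f -> Fl e f' ->
  comp_set (orb (f, triv_flag)) (orb (triv_flag, f')) = Fl d `*` Fl e.
Proof.
move=> df ef'; apply/seteqP; split=> [p [b []] | [f1 f2] [/= df1 ef2]].
  case=> g /= /(congr1 fst)/= p1E [h /= /(congr1 snd)/= p2E].
  by split; rewrite ?p1E ?p2E; apply: Fl_act.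
have [g f1E] := Fl_trans df df1; have [h f2E] := Fl_trans ef' ef2.
exists triv_flag; split; [exists g | exists h]; rewrite /= act_triv ?f1E ?f2E //.
Qed.

(** The factorisation of o_{d,e} that reduces statements on M to associativity. *)
Lemma o_orb_triv (f f' : flag V n) d e : Fl d f -> Fl e f' ->
  o_orb V d e = star (e_orb (orb (f, triv_flag))) (e_orb (orb (triv_flag, f'))).
Proof. by move=> df ef'; rewrite star_e /orbit_mul (comp_set_triv df ef'). Qed.

Lemma o_orbP d e :
  (o_orb V d e = 0 /\ forall f f', Fl d f -> ~ Fl e f') \/
  exists X p, [/\ o_orb V d e = e_orb X, val X p, Fl d p.1 & Fl e p.2].
Proof.
have [[[f f'] /= [df ef']]|/forallNP nodf] :=
  pselect (exists p : flag V n * flag V n, Fl d p.1 /\ Fl e p.2).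
  right; rewrite /o_orb -(comp_set_triv df ef').
  have S : comp_set (orb (f, triv_flag)) (orb (triv_flag, f')) (f, f').
    by rewrite (comp_set_triv df ef').
  have [z [Sz _] XE] := orbit_mul_generic S.
  rewrite /orbit_mul in XE; exists (orb z), z; rewrite XE; split=> //; first exact: orb_refl.
    by move: Sz; rewrite (comp_set_triv df ef') => -[].
  by move: Sz; rewrite (comp_set_triv df ef') => -[].
left; split=> [|f f' df ef']; last exact: (nodf (f, f')).
by rewrite /o_orb open_orbit0 // => p [dp ep]; apply: (nodf p).
Qed.

Lemma orbit_mul_one X Y p : comp_set X Y p -> comp_set X Y `<=` GLorbit p ->
  orbit_mul X Y = Some (orb p).
Proof.
move=> Sp Sorb; have [z [Sz _] ->] := orbit_mul_generic Sp.
by congr Some; apply/esym/orb_eq/Sorb.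
Qed.

(** Factor o_{d',e} through the flag 0, V, ..., V and reassociate: the product of X
    with the orbit F_{d'} x {triv_flag} is the orbit F_d x {triv_flag}. *)
Lemma star_e_o X (p : flag V n * flag V n) d d' e :
  val X p -> Fl d p.1 -> Fl d' p.2 ->
  star (e_orb X) (o_orb V d' e) = o_orb V d e.
Proof.
case: p => f f' /= Xf df d'f'.
have [[h eh]|/forallNP noe] := pselect (exists h : flag V n, Fl e h).
  rewrite (o_orb_triv d'f' eh) (o_orb_triv df eh) starA; congr (star _ _).
  rewrite star_e (@orbit_mul_one _ _ (f, triv_flag)) //.
    by exists f'; split=> //; apply: orb_refl.
  move=> p [b [Xb [g /= bE]]]; have [/= dp1 _] := orbit_Fl Xf df d'f' Xb.
  have [g1 p1E] := Fl_trans df dp1; exists g1.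
  have p2E : p.2 = act g triv_flag := congr1 snd bE.
  by rewrite [LHS]surjective_pairing p1E p2E /= !act_triv.
have o0 d0 : o_orb V d0 e = 0.
  by have [[]//|[Y [p [_ _ _ /noe]]]] := o_orbP d0 e.
by rewrite !o0 star0r.
Qed.

Lemma star_o_e X (p : flag V n * flag V n) d d' e :
  val X p -> Fl d p.1 -> Fl d' p.2 ->
  star (o_orb V e d) (e_orb X) = o_orb V e d'.
Proof.
case: p => f f' /= Xf df d'f'.
have [[h eh]|/forallNP noe] := pselect (exists h : flag V n, Fl e h).
  rewrite (o_orb_triv eh df) (o_orb_triv eh d'f') -starA; congr (star _ _).
  rewrite star_e (@orbit_mul_one _ _ (triv_flag, f')) //.
    by exists f; split=> //; apply: orb_refl.
  move=> p [b [[g /= bE] Xb]]; have [/= _ dp2] := orbit_Fl Xf df d'f' Xb.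
  have [g2 p2E] := Fl_trans d'f' dp2; exists g2.
  have p1E : p.1 = act g triv_flag := congr1 fst bE.
  by rewrite [LHS]surjective_pairing p2E p1E /= !act_triv.
have o0 d0 : o_orb V e d0 = 0.
  by have [[]//|[Y [p [_ _ /noe]]]] := o_orbP e d0.
by rewrite !o0 star0l.
Qed.

Lemma star_e_o0 X d d' d'' e : val X `<=` Fl d `*` Fl d' -> d' <> d'' ->
  star (e_orb X) (o_orb V d'' e) = 0.
Proof.
move=> Xd d'd''; have [[-> _]|[Y [p [-> Yp dp ep]]]] := o_orbP d'' e.
  by rewrite star0r.
by rewrite star_e (orbit_mul_mismatch Xd (orbit_Fl Yp dp ep)) //.
Qed.

Lemma star_o_e0 X d d' d'' e : val X `<=` Fl d `*` Fl d' -> d'' <> d ->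
  star (o_orb V e d'') (e_orb X) = 0.
Proof.
move=> Xd d'd''; have [[-> _]|[Y [p [-> Yp dp ep]]]] := o_orbP e d''.
  by rewrite star0l.
by rewrite star_e (orbit_mul_mismatch (orbit_Fl Yp dp ep) Xd) //.
Qed.

Lemma orbit_rep X : exists f f' d d',
  [/\ val X (f, f'), Fl d f, Fl d' f' & val X `<=` Fl d `*` Fl d'].
Proof.
have [[f f'] Xf] := orbit_ex X.
have [d df] := Fl_exists f; have [d' df'] := Fl_exists f'.
by exists f, f', d, d'; split=> //; apply: (orbit_Fl Xf).
Qed.

(** M is additively generated by the o_{d,e}. *)
Lemma in_M_ind (P : Gnr V n -> Prop) :
    P 0 -> (forall x y, P x -> P y -> P (x - y)) -> (forall d e, P (o_orb V d e)) ->
  forall x, x \in in_M r -> P x.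
Proof.
move=> P0 PB Po _ /asboolP[c ->]; have PD u v : P u -> P v -> P (u + v).
  by move=> Pu Pv; rewrite -[v]opprK; apply: (PB) => //; rewrite -sub0r; apply: PB.
by do 2!elim/big_ind: _ => // ? _; apply: int_scale_ind.
Qed.

Lemma in_M_o d e : o_orb V d e \in in_M r.
Proof. exact: o_in_M. Qed.

(** On generators, a product of an orbit with some o_{d,e} is either another
    o_{d,e} or 0, according to whether the adjacent jumps agree. *)
Lemma M_ideal : two_sided_ideal V n r.
Proof.
move=> x y xM; move: x xM.
apply: in_M_ind => [|u v [IHu IHu'] [IHv IHv']|d e].
- by rewrite star0l star0r rpred0.
- by rewrite starBl starBr !rpredB.
elim/Gnr_ind: y => [|u v [IHu IHu'] [IHv IHv']|X].
- by rewrite star0l star0r rpred0.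
- by rewrite starBl starBr !rpredB.
have [f [f' [a [a' [Xf af af' Xsub]]]]] := orbit_rep X.
split.
  have [->|ea] := eqVneq e a; first by rewrite (star_o_e _ Xf af af') in_M_o.
  by rewrite (star_o_e0 _ Xsub) ?rpred0 //; apply/eqP.
have [->|da] := eqVneq d a'; first by rewrite (star_e_o _ Xf af af') in_M_o.
by rewrite (star_e_o0 _ Xsub) ?rpred0 //; apply/eqP; rewrite eq_sym.
Qed.

(** * The unit of G(n, r) *)

(** The d-th summand of the unit of G(n, r). *)
Definition diag d : Gnr V n :=
  e_opt (insub [set p : flag V n * flag V n | Fl d p.1 /\ p.2 = p.1]).

Lemma diagE d f : Fl d f -> diag d = e_orb (orb (f, f)).
Proof.
move=> df; rewrite /diag.
have -> : [set p : flag V n * flag V n | Fl d p.1 /\ p.2 = p.1] = val (orb (f, f)).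
  apply/seteqP; split=> [[f1 f2] [/= df1 ->]|_ [g ->]]; last by split=> //; apply: Fl_act.
  by have [g ->] := Fl_trans df df1; exists g.
by rewrite valK.
Qed.

Lemma diag0 d : (forall f, ~ Fl d f) -> diag d = 0.
Proof.
move=> d0; rewrite /diag; case: insubP => // X _ XE.
by have [p] := orbit_ex X; rewrite XE => -[/d0].
Qed.

Lemma diag_sub d f : Fl d f -> val (orb (f, f)) `<=` Fl d `*` Fl d.
Proof. by move=> df; apply: (orbit_Fl (orb_refl _)). Qed.

Lemma star_diag_e d e e' X : val X `<=` Fl e `*` Fl e' ->
  star (diag d) (e_orb X) = if d == e then e_orb X else 0.
Proof.
move=> Xe; have [p Xp] := orbit_ex X; have [ep ep'] := Xe p Xp.
have [->|/eqP de] := eqVneq d e; last first.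
  have [[f df]|/forallNP d0] := pselect (exists f : flag V n, Fl d f); last first.
    by rewrite (diag0 d0) star0l.
  by rewrite (diagE df) star_e (orbit_mul_mismatch (diag_sub df) Xe).
rewrite (diagE ep) star_e (@orbit_mul_one _ _ p) /= ?(orb_eq Xp) //.
  by exists p.1; split; [apply: orb_refl | rewrite -surjective_pairing; apply: orb_refl].
move=> q [b [[g /= qE] Xb]].
have q1E : q.1 = b := etrans (congr1 fst qE) (esym (congr1 snd qE)).
by rewrite [q]surjective_pairing q1E.
Qed.

Lemma star_e_diag d e e' X : val X `<=` Fl e' `*` Fl e ->
  star (e_orb X) (diag d) = if d == e then e_orb X else 0.
Proof.
move=> Xe; have [p Xp] := orbit_ex X; have [ep' ep] := Xe p Xp.
have [->|/eqP de] := eqVneq d e; last first.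
  have [[f df]|/forallNP d0] := pselect (exists f : flag V n, Fl d f); last first.
    by rewrite (diag0 d0) star0r.
  by rewrite (diagE df) star_e (orbit_mul_mismatch Xe (diag_sub df)) //; apply/nesym.
rewrite (diagE ep) star_e (@orbit_mul_one _ _ p) /= ?(orb_eq Xp) //.
  by exists p.2; split; [rewrite -surjective_pairing; apply: orb_refl | apply: orb_refl].
move=> q [b [Xb [g /= qE]]].
have q2E : q.2 = b := etrans (congr1 snd qE) (esym (congr1 fst qE)).
by rewrite [q]surjective_pairing q2E.
Qed.

Lemma star1l : left_id (G_one V n r) (@star k V n).
Proof.
move=> x; elim/Gnr_ind: x => [|u v IHu IHv|X]; first by rewrite star0r.
  by rewrite starBr IHu IHv.
have [f [f' [d [d' [Xf df df' Xsub]]]]] := orbit_rep X.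
rewrite star_suml (bigD1 d) //= -/(diag d) (star_diag_e _ Xsub) eqxx.
rewrite big1 ?addr0 // => e ed; rewrite -/(diag e) (star_diag_e _ Xsub).
by rewrite (negPf ed).
Qed.

Lemma star1r : right_id (G_one V n r) (@star k V n).
Proof.
move=> x; elim/Gnr_ind: x => [|u v IHu IHv|X]; first by rewrite star0l.
  by rewrite starBl IHu IHv.
have [f [f' [d [d' [Xf df df' Xsub]]]]] := orbit_rep X.
rewrite star_sumr (bigD1 d') //= -/(diag d') (star_e_diag _ Xsub) eqxx.
rewrite big1 ?addr0 // => e ed; rewrite -/(diag e) (star_e_diag _ Xsub).
by rewrite (negPf ed).
Qed.

Lemma G_Zalgebra : Zalgebra (@star k V n) (G_one V n r).
Proof.
split; [exact: starA|exact: star1l|exact: star1r| |].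
  by move=> x y z; apply: starDl.
by move=> x y z; apply: starDr.
Qed.

(** * The algebras M(n, r) and G(n, r) / M(n, r) *)

Lemma val_M_mul (x y : Mnr V n r) : val (M_mul x y) = star (val x) (val y).
Proof. by rewrite /M_mul insubdK //; apply: (M_ideal _ _).1; apply: valP. Qed.

Lemma val_M_one : val (M_one V n r) = \sum_(d : Dnr n r) o_orb V d d.
Proof. by rewrite /M_one raddf_sum. Qed.

Lemma star_oo_o d d' e :
  star (o_orb V d d) (o_orb V d' e) = if d == d' then o_orb V d e else 0.
Proof.
have [[oE no]|[X [p [oE Xp dp ep]]]] := o_orbP d' e.
  by rewrite oE star0r; case: eqP => // ->; rewrite oE.
have Xsub := orbit_Fl Xp dp ep.
rewrite oE; have [->|/eqP dd'] := eqVneq d d'; last by rewrite (star_o_e0 _ Xsub).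
by rewrite (star_o_e _ Xp dp ep).
Qed.

Lemma star_o_oo d e e' :
  star (o_orb V d e) (o_orb V e' e') = if e == e' then o_orb V d e else 0.
Proof.
have [[oE no]|[X [p [oE Xp dp ep]]]] := o_orbP d e.
  by rewrite oE star0l if_same.
have Xsub := orbit_Fl Xp dp ep.
rewrite oE; have [<-|/eqP dd'] := eqVneq e e'; last by rewrite (star_e_o0 _ Xsub).
by rewrite (star_e_o _ Xp dp ep).
Qed.

Lemma M_one_l x : x \in in_M r -> star (val (M_one V n r)) x = x.
Proof.
move: x; apply: in_M_ind => [|u v IHu IHv|d e]; first by rewrite star0r.
  by rewrite starBr IHu IHv.
rewrite val_M_one star_suml (bigD1 d) //= star_oo_o eqxx big1 ?addr0 // => d' dd'.
by rewrite star_oo_o (negPf dd').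
Qed.

Lemma M_one_r x : x \in in_M r -> star x (val (M_one V n r)) = x.
Proof.
move: x; apply: in_M_ind => [|u v IHu IHv|d e]; first by rewrite star0l.
  by rewrite starBl IHu IHv.
rewrite val_M_one star_sumr (bigD1 e) //= star_o_oo eqxx big1 ?addr0 // => d' dd'.
by rewrite star_o_oo eq_sym (negPf dd').
Qed.

Lemma M_Zalgebra : Zalgebra (@M_mul k V n r) (M_one V n r).
Proof.
split=> [x y z|x|x|x y z|x y z]; apply/val_inj.
- by rewrite !val_M_mul starA.
- by rewrite val_M_mul M_one_l //; apply: valP.
- by rewrite val_M_mul M_one_r //; apply: valP.
- by rewrite val_M_mul !raddfD /= starDl !val_M_mul.
- by rewrite val_M_mul !raddfD /= starDr !val_M_mul.
Qed.

Lemma clsP x y : cls r x = cls r y <-> x - y \in in_M r.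
Proof.
split=> [/eqP|xy]; first by rewrite Quotient.idealrBE.
by apply/eqP; rewrite -Quotient.idealrBE.
Qed.

Lemma clsD : {morph cls (V := V) (n := n) r : x y / x + y}.
Proof. by move=> x y; rewrite /cls raddfD. Qed.

Lemma cls_repr (u : GmodM V n r) : exists x, u = cls r x.
Proof. by exists (repr u); rewrite /cls reprK. Qed.

(** The representatives differ from x and y by elements of the ideal M. *)
Lemma cls_mul x y : GmodM_mul (cls r x) (cls r y) = cls r (star x y).
Proof.
have clsK z : repr (cls r z) - z \in in_M r by apply/clsP; rewrite /cls reprK.
rewrite /GmodM_mul; apply/clsP.
rewrite -[X in X - _](subrK (star x (repr (cls r y)))) -addrA -starBl -starBr.
by rewrite rpredD //; [apply: (M_ideal _ _).1 | apply: (M_ideal _ _).2].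
Qed.

Lemma GmodM_Zalgebra : Zalgebra (@GmodM_mul k V n r) (GmodM_one V n r).
Proof.
split=> [u v w|u|u|u v w|u v w];
  have [x ->] := cls_repr u; try have [y ->] := cls_repr v;
  try have [z ->] := cls_repr w; rewrite ?cls_mul.
- by rewrite starA.
- by rewrite star1l.
- by rewrite star1r.
- by rewrite -!clsD cls_mul starDl.
- by rewrite -!clsD cls_mul starDr.
Qed.

(** * The decomposition of G(n, r) *)

Lemma omega_orbitE X d e : val X `<=` Fl d `*` Fl e -> omega_orbit r X = oM V d e.
Proof.
move=> Xsub; have [p Xp] := orbit_ex X; have [dp ep] := Xsub p Xp.
rewrite /omega_orbit; case: pickP => [[d' e'] /asboolP/(_ p Xp)[/= dp' ep']|/(_ (d, e))].
  by rewrite (Fl_inj dp dp') (Fl_inj ep ep').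
by move=> /asboolP.
Qed.

Lemma omegaB x y : omega r (x - y) = omega r x - omega r y :> Mnr V n r.
Proof. exact: lift_is_additive. Qed.

Lemma omega0 : omega r (0 : Gnr V n) = 0.
Proof. by have := omegaB 0 0; rewrite !subrr. Qed.

Lemma omegaD x y : omega r (x + y) = omega r x + omega r y :> Mnr V n r.
Proof. by rewrite -[y in LHS]opprK omegaB -sub0r omegaB omega0 sub0r opprK. Qed.

Lemma omega_e X d e : val X `<=` Fl d `*` Fl e -> omega r (e_orb X) = oM V d e.
Proof. by move=> Xsub; rewrite /omega fglift_e (omega_orbitE Xsub). Qed.

(** omega is a retraction onto M: the open orbit of F_d x F_e lies in F_d x F_e. *)
Lemma omega_M x : x \in in_M r -> val (omega r x) = x.
Proof.
move: x; apply: in_M_ind => [|u v IHu IHv|d e].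
- by rewrite omega0 raddf0.
- by rewrite omegaB raddfB /= IHu IHv.
have [[-> _]|[X [p [oE Xp dp ep]]]] := o_orbP d e; first by rewrite omega0 raddf0.
by rewrite {1}oE (omega_e (orbit_Fl Xp dp ep)).
Qed.

(** On orbits with matching jumps, both sides are o_{d,e'}: on the left because the
    product of X and Y lies in F_d x F_e', on the right by star_e_o.  Otherwise
    both vanish. *)
Lemma omega_mul x y :
  val (omega r (star x y)) = star (val (omega r x)) (val (omega r y)).
Proof.
elim/Gnr_ind: x => [|u v IHu IHv|X].
- by rewrite star0l omega0 raddf0 star0l.
- by rewrite starBl !omegaB !raddfB /= starBl IHu IHv.
elim/Gnr_ind: y => [|u v IHu IHv|Y].
- by rewrite star0r omega0 raddf0 star0r.
- by rewrite starBr !omegaB !raddfB /= starBr IHu IHv.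
have [f [f' [d [d' [Xf df df' Xsub]]]]] := orbit_rep X.
have [h [h' [e [e' [Yh eh eh' Ysub]]]]] := orbit_rep Y.
have val_oM a b : val (oM V a b : Mnr V n r) = o_orb V a b by [].
rewrite (omega_e Xsub) (omega_e Ysub) !val_oM star_e.
have [[_ /(_ _ _ df df')//]|[O [p [oE Op dp dp']]]] := o_orbP d d'.
have Osub := orbit_Fl Op dp dp'.
rewrite oE; have [de|/eqP de] := eqVneq d' e; last first.
  by rewrite (orbit_mul_mismatch Xsub Ysub) // omega0 raddf0 (star_e_o0 _ Osub).
rewrite -de (star_e_o _ Op dp dp').
rewrite -de in eh; have [g hE] := Fl_trans df' eh.
have S : comp_set X Y (f, act (GLinv g) h').
  exists f'; split=> //=; rewrite -(actK g f') -hE.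
  exact: (orbit_act Y (GLinv g) (h, h')).2.
have [z [Sz _] ->] := orbit_mul_generic S.
have [b [/Xsub[/= dz _] /Ysub[/= _ ez]]] := Sz.
by rewrite (omega_e (orbit_Fl (orb_refl z) dz ez)) val_oM.
Qed.

Definition split_map x : Mnr V n r * GmodM V n r := (omega r x, cls r x).

(** The inverse sends (m, u) to y - omega y + m, for any representative y of u:
    the first difference is killed by omega and represents u. *)
Lemma split_map_iso : Zalgebra_iso (@star k V n) (G_one V n r)
  (@prod_mul k V n r) (prod_one V n r) split_map.
Proof.
split.
- by move=> x y; congr (_, _); [apply: omegaD | apply: clsD].
- move=> x y; congr (_, _); last by rewrite /= cls_mul.
  by apply/val_inj; rewrite omega_mul val_M_mul.
- congr (_, _); apply/val_inj; rewrite val_M_one /G_one.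
  rewrite (big_morph _ omegaD omega0) raddf_sum; apply: eq_bigr => d _.
  rewrite -/(diag d); have [[f df]|/forallNP d0] := pselect (exists f : flag V n, Fl d f).
    by rewrite (diagE df) (omega_e (diag_sub df)).
  by rewrite (diag0 d0) omega0 raddf0; have [[-> _]//|[? [? [_ _ /d0]]]] := o_orbP d d.
pose inv (mu : Mnr V n r * GmodM V n r) := repr mu.2 - val (omega r (repr mu.2)) + val mu.1.
exists inv => [x | [m u]].
  rewrite /inv /=; set y := repr _.
  have xyM : y - x \in in_M r by apply/clsP; rewrite /cls reprK.
  have := omega_M xyM; rewrite omegaB raddfB /= => /(canRL (subrK _)) ->.
  by rewrite opprD addrA subKr addrNK.
rewrite /inv /split_map /=.
have omega_val (m' : Mnr V n r) : omega r (val m') = m'.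
  by apply/val_inj/omega_M/valP.
congr (_, _); first by rewrite omegaD omegaB !omega_val subrr add0r.
have -> : u = cls r (repr u) by rewrite /cls reprK.
apply/clsP; rewrite /cls reprK addrAC [_ - _ - _]addrAC subrr add0r.
by rewrite rpredD ?rpredN //; apply: valP.
Qed.

End GenericAlgebra.

Theorem theorem9p9 (k : closedFieldType) (V : vectType k) (n r : nat)
    (hn : (1 <= n)%N) (hr : (1 <= r)%N) (hV : \dim (fullv : {vspace V}) = r) :
  [/\ Zalgebra (@star k V n) (G_one V n r),
      two_sided_ideal V n r,
      Zalgebra (@M_mul k V n r) (M_one V n r),
      Zalgebra (@GmodM_mul k V n r) (GmodM_one V n r) &
      exists phi : Gnr V n -> (Mnr V n r * GmodM V n r)%type,
        Zalgebra_iso (@star k V n) (G_one V n r)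
                     (@prod_mul k V n r) (prod_one V n r) phi /\
        forall X : orbit_type V n,
          phi (e_orb X) = (omega r (e_orb X), cls r (e_orb X))].
Proof.
split.
- exact: G_Zalgebra.
- exact: M_ideal.
- exact: M_Zalgebra.
- exact: GmodM_Zalgebra.
by exists (@split_map k V n r); split=> //; apply: split_map_iso.
Qed.
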